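(* Consider the penalized scenario-based Value-at-Risk portfolio problem $\min_{\mathbf{w}\in\Delta}\ \phi(\mathbf{w}) := g(\mathbf{w}) - h(\mathbf{w})$ and the sequence $\{\mathbf{w}_k\}$ generated by the Boosted DC Algorithm (BDCA) with the line search, both as described in the context. Let $\bar{\mathbf{w}}\in\Delta$ be a limit point of $\{\mathbf{w}_k\}$. If $\nabla g$ or $\nabla h$ is locally Lipschitz continuous around $\bar{\mathbf{w}}$, then the sequence $\{\mathbf{w}_k\}$ converges linearly to $\bar{\mathbf{w}}$.
   Context: Data: $n,S\in\mathbb{N}$; scenario vectors $\mathbf{x}_1,\dots,\mathbf{x}_S\in\mathbb{R}^n$ with probabilities $p_1,\dots,p_S\in[0,1]$, $\sum_j p_j=1$. The feasible set is the simplex $\Delta=\{\mathbf{w}\in[0,1]^n:\sum_{i=1}^n w_i=1\}$. For $\mathbf{w}\in\mathbb{R}^n$ relabel the scenarios so that $\mathbf{w}^\top\mathbf{x}_1\le\cdots\le\mathbf{w}^\top\mathbf{x}_S$; for a level $a\in(0,1)$ let $k=\max\{k: \sum_{j=1}^k p_j< a\}$ (with $\max\emptyset=0$) and $\varepsilon=a-\sum_{j=1}^k p_j$, and define the discrete conditional value-at-risk $\mathrm{CVaR}_{X,a}(\mathbf{w})=\frac1a\sum_{j=1}^k p_j\,\mathbf{w}^\top\mathbf{x}_j+\frac{\varepsilon}{a}\,\mathbf{w}^\top\mathbf{x}_{k+1}$ (a concave piecewise linear function of $\mathbf{w}$). Fix $\alpha\in(0,1)$, with $k,\varepsilon$ the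 quantities above for level $\alpha$, a constant $\gamma$ with $0<\gamma<\varepsilon$, a threshold $r_{\min}\in\mathbb{R}$, a penalty parameter $\tau>0$, a regularization parameter $\rho>0$, and $\psi(\mathbf{w})=\frac{\rho}{2}\|\mathbf{w}\|^2$. Let $f(\mathbf{w})=-\sum_{j=1}^S p_j\,\mathbf{w}^\top\mathbf{x}_j$ and $g(\mathbf{w})=\psi(\mathbf{w})+f(\mathbf{w})+\tau\max\big[-\tfrac{\alpha}{\gamma}\mathrm{CVaR}_{X,\alpha}(\mathbf{w})+r_{\min},\ -\tfrac{\alpha-\gamma}{\gamma}\mathrm{CVaR}_{X,\alpha-\gamma}(\mathbf{w})\big]$, $h(\mathbf{w})=\psi(\mathbf{w})-\tau\,\tfrac{\alpha-\gamma}{\gamma}\mathrm{CVaR}_{X,\alpha-\gamma}(\mathbf{w})$, and $\phi=g-h$. BDCA: input $\mathbf{w}_0\in\Delta$, $\tau,\rho>0$, $\beta\in(0,1)$. For $k=0,1,2,\dots$: choose $\mathbf{u}_k\in\partial h(\mathbf{w}_k)$ (convex subdifferential); let $\mathbf{y}_k=\arg\min_{\mathbf{w}\in\Delta}\{g(\mathbf{w})-\mathbf{w}^\top\mathbf{u}_k\}$; $\mathbf{d}_k=\mathbf{y}_k-\mathbf{w}_k$; if $\|\mathbf{d}_k\|=0$ stop; otherwise set $\lambda_k=\max\{\lambda: \mathbf{w}_k+\lambda\mathbf{d}_k\in\Delta\}$ and, while $\phi(\mathbf{w}_k+\lambda_k\mathbf{d}_k)>\phi(\mathbf{w}_k)-\rho\lambda_k^2\|\mathbf{d}_k\|^2$,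 replace $\lambda_k$ by $\max\{1,\beta\lambda_k\}$; then set $\mathbf{w}_{k+1}=\mathbf{w}_k+\lambda_k\mathbf{d}_k$. *)

(* Defs.v *)
From HB Require Import structures.
From mathcomp Require Import all_boot all_order all_algebra.
From mathcomp Require Import all_classical all_reals all_analysis.
Set Implicit Arguments. Unset Strict Implicit. Unset Printing Implicit Defensive.
Import Order.TTheory GRing.Theory Num.Theory.
Import numFieldNormedType.Exports.
Local Open Scope ring_scope.

Section Defs.
Variable R : realType.

Definition dotv n (u v : 'rV[R]_n) : R := \sum_(i < n) u 0 i * v 0 i.
Definition enorm n (v : 'rV[R]_n) : R := Num.sqrt (dotv v v).

Definition simplex n (w : 'rV[R]_n) : Prop :=
  (forall i, 0 <= w 0 i <= 1) /\ \sum_(i < n) w 0 i = 1.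

Variables (n S : nat) (x : 'I_S -> 'rV[R]_n) (p : 'I_S -> R).

Definition sorted_scen (w : 'rV[R]_n) : seq (R * R) :=
  [seq (p i, dotv w (x i)) |
     i <- sort (fun i j : 'I_S => dotv w (x i) <= dotv w (x j)) (enum 'I_S)].

Definition cum_prob (w : 'rV[R]_n) (m : nat) : R :=
  \sum_(q <- take m (sorted_scen w)) q.1.

(* k = max{k : sum_{j<=k} p_j < a}  (max of empty set = 0) *)
Definition cvar_k (a : R) (w : 'rV[R]_n) : nat :=
  \max_(m < S.+1 | cum_prob w m < a) m.

Definition cvar_eps (a : R) (w : 'rV[R]_n) : R := a - cum_prob w (cvar_k a w).

Definition CVaR (a : R) (w : 'rV[R]_n) : R :=
  a^-1 * (\sum_(q <- take (cvar_k a w) (sorted_scen w)) q.1 * q.2)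
  + (cvar_eps a w / a) * (nth (0, 0) (sorted_scen w) (cvar_k a w)).2.

Variables (alpha gamma rmin tau rho : R).

Definition psi (w : 'rV[R]_n) : R := rho / 2 * enorm w ^+ 2.
Definition ffun (w : 'rV[R]_n) : R := - \sum_(j < S) p j * dotv w (x j).

Definition gfun (w : 'rV[R]_n) : R :=
  psi w + ffun w +
  tau * Num.max (- (alpha / gamma) * CVaR alpha w + rmin)
                (- ((alpha - gamma) / gamma) * CVaR (alpha - gamma) w).

Definition hfun (w : 'rV[R]_n) : R :=
  psi w - tau * ((alpha - gamma) / gamma) * CVaR (alpha - gamma) w.

Definition phi (w : 'rV[R]_n) : R := gfun w - hfun w.

Definition subgrad (F : 'rV[R]_n -> R) (w u : 'rV[R]_n) : Prop :=
  forall v, F w + dotv u (v - w) <= F v.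

(* one iteration of BDCA, from w_k to w_{k+1}; if d_k = 0 the algorithm
   stops, which we encode by w_{k+1} = w_k (the sequence becomes constant) *)
Definition bdca_step (beta : R) (wk wk1 : 'rV[R]_n) : Prop :=
  exists u y : 'rV[R]_n,
    subgrad hfun wk u /\
    (simplex y /\ forall v, simplex v -> gfun y - dotv y u <= gfun v - dotv v u) /\
    let d := y - wk in
    (d = 0 /\ wk1 = wk) \/
    (d != 0 /\
     exists lam0 : R,
       (simplex (wk + lam0 *: d) /\
        forall l, simplex (wk + l *: d) -> l <= lam0) /\
       let lam j := iter j (fun l => Num.max 1 (beta * l)) lam0 in
       let armijo l := phi (wk + l *: d) <= phi wk - rho * l ^+ 2 * enorm d ^+ 2 in
       exists j : nat,
         (forall i, (i < j)%N -> ~ armijo (lam i)) /\ armijo (lam j) /\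
         wk1 = wk + lam j *: d).

End Defs.

Definition grad (R : realType) n (F : 'rV[R]_n -> R) (z : 'rV[R]_n) : 'rV[R]_n :=
  \row_i ('d F z) (delta_mx 0 i).

Definition loc_lip_grad (R : realType) n (F : 'rV[R]_n -> R) (wbar : 'rV[R]_n) : Prop :=
  exists r : R, 0 < r /\ exists L : R,
    (forall z, enorm (z - wbar) < r -> differentiable F z) /\
    (forall z1 z2, enorm (z1 - wbar) < r -> enorm (z2 - wbar) < r ->
       enorm (grad F z1 - grad F z2) <= L * enorm (z1 - z2)).

(* Main.v *)
Require Import Defs.
From HB Require Import structures.
From mathcomp Require Import all_boot all_order all_algebra.
From mathcomp Require Import all_classical all_reals all_analysis.
From mathcomp Require Import ring lra.
Import Order.TTheory GRing.Theory Num.Theory.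
Import numFieldNormedType.Exports.
Set Implicit Arguments. Unset Strict Implicit. Unset Printing Implicit Defensive.
Local Open Scope ring_scope.

(** The quadratic terms of g and h cancel in phi = G - H, where G and H are the
polyhedral (finite maximum of affine functions) parts of g and h: a * CVaR_a is the
minimum of sum_j q_j w.x_j over the vertices of {0 <= q <= p, sum_j q_j = a}.
Differentiability of g or h at the limit point wbar forces G or H to be affine near
wbar.  The line search makes phi(w_k) decrease to phi(wbar) and the steps tend to 0.

If G is affine near wbar, normal cones and subdifferentials take finitely many values
along the iterates; comparing the optimality conditions at a fixed k with those at
later iterates of the same type, whose steps are arbitrarily small, yields
phi(w_(k+1)) <= phi(wbar), so the sequence is eventually constant.

If H is affine near wbar, y_k is a proximal point of a convex polyhedral function F.
Small proximal steps end at minimizers of F, and <w_k - wbar, m - wbar> is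
nondecreasing in k for every minimizer m; since wbar is a limit point this forces
y_k = wbar eventually.  Then w_(k+1) overshoots wbar along a fixed line, from
alternating sides.  As phi decreases, the overshoots on each side decrease, which is
only possible if each step on one side is backtracked once more than the previous
step on that side: the step lengths decrease by a factor beta every two iterations. *)

(** * Euclidean space *)

Lemma addrK_l (V : zmodType) (u v : V) : u + v - u = v.
Proof. by rewrite addrC addKr. Qed.

Section Euclidean.
Variables (R : realType) (n : nat).
Implicit Types (u v w : 'rV[R]_n) (c : R).

Lemma dotvC u v : dotv u v = dotv v u.
Proof. by apply: eq_bigr => i _; rewrite mulrC. Qed.

Lemma dotvDl u v w : dotv (u + v) w = dotv u w + dotv v w.
Proof. by rewrite -big_split; apply: eq_bigr => i _; rewrite mxE mulrDl. Qed.

Lemma dotvZl c u v : dotv (c *: u) v = c * dotv u v.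
Proof. by rewrite [RHS]mulr_sumr; apply: eq_bigr => i _; rewrite mxE mulrA. Qed.

Lemma dotvNl u v : dotv (- u) v = - dotv u v.
Proof. by rewrite -scaleN1r dotvZl mulN1r. Qed.

Lemma dotvDr u v w : dotv u (v + w) = dotv u v + dotv u w.
Proof. by rewrite dotvC dotvDl !(dotvC u). Qed.

Lemma dotvZr c u v : dotv u (c *: v) = c * dotv u v.
Proof. by rewrite dotvC dotvZl dotvC. Qed.

Lemma dotvNr u v : dotv u (- v) = - dotv u v.
Proof. by rewrite dotvC dotvNl dotvC. Qed.

Lemma dot0v v : dotv 0 v = 0.
Proof. by rewrite -(scale0r v) dotvZl mul0r. Qed.

Definition dotvE := (dotvDl, dotvDr, dotvNl, dotvNr, dotvZl, dotvZr).

Lemma dotv_suml (I : finType) (P : pred I) (f : I -> 'rV[R]_n) v :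
  dotv (\sum_(i | P i) f i) v = \sum_(i | P i) dotv (f i) v.
Proof.
rewrite /dotv exchange_big; apply: eq_bigr => j _.
by rewrite summxE mulr_suml.
Qed.

Lemma dotvv_ge0 v : 0 <= dotv v v.
Proof. by apply: sumr_ge0 => i _; rewrite -expr2 sqr_ge0. Qed.

Lemma dotvv_eq0 v : dotv v v <= 0 -> v = 0.
Proof.
move=> v0; apply/matrixP => i j; rewrite ord1 mxE; apply/eqP.
have /eqP : dotv v v = 0 by apply/eqP; rewrite eq_le v0 dotvv_ge0.
rewrite /dotv psumr_eq0 => [/allP/(_ j (mem_index_enum _)) /=|k _].
  by rewrite mulf_eq0 orbb.
by rewrite -expr2 sqr_ge0.
Qed.

Lemma enorm_ge0 v : 0 <= enorm v. Proof. exact: sqrtr_ge0. Qed.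

Lemma sqr_enorm v : enorm v ^+ 2 = dotv v v.
Proof. by rewrite sqr_sqrtr // dotvv_ge0. Qed.

Lemma enorm0 : enorm (0 : 'rV[R]_n) = 0.
Proof. by rewrite /enorm dot0v sqrtr0. Qed.

Lemma enorm_eq0 v : enorm v <= 0 -> v = 0.
Proof.
move=> v0; apply: dotvv_eq0; rewrite -sqr_enorm.
by have := enorm_ge0 v; nra.
Qed.

Lemma enorm_gt0 v : v != 0 -> 0 < enorm v.
Proof.
by move=> v0; rewrite ltNge; apply: contra v0 => /enorm_eq0 ->.
Qed.

Lemma enormZ c v : enorm (c *: v) = `|c| * enorm v.
Proof. by rewrite /enorm !dotvE mulrA -expr2 sqrtrM ?sqr_ge0 // sqrtr_sqr. Qed.

Lemma enormN v : enorm (- v) = enorm v.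
Proof. by rewrite -scaleN1r enormZ normrN1 mul1r. Qed.

Lemma enormB u v : enorm (u - v) = enorm (v - u).
Proof. by rewrite -enormN opprB. Qed.

Lemma dotv_le_enorm u v : dotv u v <= enorm u * enorm v.
Proof.
have [->|u0] := eqVneq u 0; first by rewrite dot0v enorm0 mul0r.
have [->|v0] := eqVneq v 0; first by rewrite dotvC dot0v enorm0 mulr0.
have a0 := enorm_gt0 u0; have b0 := enorm_gt0 v0.
have := dotvv_ge0 (enorm v *: u - enorm u *: v).
rewrite !dotvE (dotvC v u) -!sqr_enorm => h.
by rewrite -subr_ge0 -(pmulr_rge0 _ (mulr_gt0 a0 b0)); lra.
Qed.

Lemma normr_dotv_le u v : `|dotv u v| <= enorm u * enorm v.
Proof.
rewrite ler_norml dotv_le_enorm andbT lerNl -dotvNl.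
by rewrite -(enormN u) dotv_le_enorm.
Qed.

Lemma enorm_le_of_sqr_le_dotv u v : enorm u ^+ 2 <= dotv v u -> enorm u <= enorm v.
Proof.
have [->|u0] := eqVneq u 0; first by rewrite enorm0 enorm_ge0.
move=> h; rewrite -(ler_pM2r (enorm_gt0 u0)) -expr2.
exact: le_trans h (dotv_le_enorm _ _).
Qed.

Lemma enormD u v : enorm (u + v) <= enorm u + enorm v.
Proof.
rewrite -(@ler_pXn2r _ 2) ?nnegrE ?addr_ge0 ?enorm_ge0 //.
rewrite sqrrD !sqr_enorm !dotvE (dotvC v u).
by have := dotv_le_enorm u v; lra.
Qed.

Lemma enorm_triangle w u v : enorm (u - v) <= enorm (u - w) + enorm (w - v).
Proof. by rewrite (_ : u - v = (u - w) + (w - v)) ?enormD // addrA subrK. Qed.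

Lemma normr_coord_le v (i : 'I_n) : `|v 0 i| <= enorm v.
Proof.
rewrite -sqrtr_sqr ler_wsqrtr // /dotv (bigD1 i) //= -expr2 lerDl.
by apply: sumr_ge0 => j _; rewrite -expr2 sqr_ge0.
Qed.

End Euclidean.

(** Finitely many positive radii have a positive minimum; the initial value [1] covers an empty
    [I]. *)
Lemma common_radius (R : realType) (I : finType) (P : I -> R -> Prop) :
  (forall i r r', r' <= r -> P i r -> P i r') ->
  (forall i, exists2 r, 0 < r & P i r) ->
  exists2 r, 0 < r & forall i, P i r.
Proof.
move=> Pmono Pex.
have /choice [r rP] i : exists r, 0 < r /\ P i r.
  by have [r] := Pex i; exists r.
exists (\big[Num.min/1]_i r i).
  by elim/big_ind: _ => // [? ? ? ?|i _]; rewrite ?lt_min; [apply/andP|case: (rP i)].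
by move=> i; apply: Pmono (rP i).2; rewrite (bigD1 i) //= ge_min lexx.
Qed.

(** Dividing by [s] and letting [s] tend to 0 removes [B]. This turns minimality along a segment
    into a first-order condition. *)
Lemma le0_of_le_quadratic (R : realType) (A B s0 : R) :
  0 < s0 -> (forall s, 0 < s <= s0 -> s * A <= s ^+ 2 * B) -> A <= 0.
Proof.
move=> s0_gt0 h; rewrite leNgt; apply/negP => A0.
have B1 : 0 < `|B| + 1 by rewrite ltr_wpDl.
pose s := Num.min s0 (A / (`|B| + 1) / 2).
have s_gt0 : 0 < s by rewrite lt_min s0_gt0 !divr_gt0.
have ss0 : s <= s0 by rewrite ge_min lexx.
have sA : s * (`|B| + 1) <= A / 2.
  by rewrite -ler_pdivlMr // mulrAC ge_min lexx orbT.
have := h s; rewrite s_gt0 ss0 => /(_ isT).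
rewrite expr2 -mulrA ler_pM2l // => AB.
have : s * B <= s * (`|B| + 1).
  by rewrite ler_pM2l // (le_trans (ler_norm B)) // lerDl.
lra.
Qed.

(** * The simplex *)

Section Simplex.
Variables (R : realType) (n : nat).
Implicit Types (u v w y z : 'rV[R]_n) (c : R).

Lemma simplex_intro v :
  (forall i, 0 <= v 0 i) -> \sum_(i < n) v 0 i = 1 -> simplex v.
Proof.
move=> v0 v1; split=> // i; rewrite v0 /= -v1 (bigD1 i) //= lerDl.
exact: sumr_ge0.
Qed.

Lemma simplex_segment y v c :
  simplex y -> simplex v -> 0 <= c <= 1 -> simplex (y + c *: (v - y)).
Proof.
move=> [y0 y1] [v0 v1] /andP[c0 c1]; apply: simplex_intro => [i|].
  rewrite !mxE; have /andP[yi _] := y0 i; have /andP[vi _] := v0 i; nra.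
under eq_bigr do rewrite !mxE.
by rewrite big_split /= -mulr_sumr sumrB y1 v1 subrr mulr0 addr0.
Qed.

Lemma simplex_between w d c c' :
  simplex w -> simplex (w + c' *: d) -> 0 <= c <= c' -> simplex (w + c *: d).
Proof.
move=> sw sc /andP[c0 cc'].
have [c'0|c'0] := eqVneq c' 0.
  have -> : c = 0 by apply/eqP; rewrite eq_le c0 andbT -c'0.
  by rewrite scale0r addr0.
have c'_gt0 : 0 < c' by rewrite lt_neqAle eq_sym c'0 (le_trans c0).
have -> : w + c *: d = w + (c / c') *: (w + c' *: d - w).
  by rewrite addrK_l scalerA divfK.
by apply: simplex_segment; rewrite ?divr_ge0 ?(ltW c'_gt0) //= ler_pdivrMr // mul1r.
Qed.

(** Only coordinates where [y] vanishes can turn negative at once, and there [z] vanishes too, so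
    [v - z] is nonnegative. *)
Lemma simplex_shift y v z :
  simplex y -> simplex v -> simplex z -> (forall i, y 0 i = 0 -> z 0 i = 0) ->
  exists2 r : R, 0 < r & forall c, 0 < c <= r -> simplex (y + c *: (v - z)).
Proof.
move=> [y0 y1] [v0 v1] [z0 z1] yz.
have [|i|r r0 rP] := @common_radius R 'I_n
   (fun i r => forall c, 0 < c <= r -> 0 <= (y + c *: (v - z)) 0 i).
- by move=> i r r' rr' + c /andP[c0 cr]; apply; rewrite c0 (le_trans cr).
- have [yi0|yi0] := eqVneq (y 0 i) 0.
    exists 1 => // c /andP[c0 _]; rewrite !mxE yi0 (yz _ yi0) add0r subr0.
    by apply: mulr_ge0; [exact: ltW|case/andP: (v0 i)].
  have yi_gt0 : 0 < y 0 i by rewrite lt_neqAle eq_sym yi0; case/andP: (y0 i).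
  exists (y 0 i) => // c /andP[c0 cy]; rewrite !mxE.
  by have /andP[? ?] := v0 i; have /andP[? ?] := z0 i; nra.
- exists r => // c cr; apply: simplex_intro => [i|]; first exact: rP.
  under eq_bigr do rewrite !mxE.
  by rewrite big_split /= -mulr_sumr sumrB y1 v1 z1 subrr mulr0 addr0.
Qed.

Lemma simplex_support_near z : simplex z ->
  exists2 r : R, 0 < r & forall y, enorm (y - z) < r ->
    forall i, y 0 i = 0 -> z 0 i = 0.
Proof.
move=> [z0 _].
have [|i|r r0 rP] := @common_radius R 'I_n
   (fun i r => forall y, enorm (y - z) < r -> y 0 i = 0 -> z 0 i = 0).
- by move=> i r r' rr' + y yr; apply; exact: lt_le_trans rr'.
- have [zi0|zi0] := eqVneq (z 0 i) 0; first by exists 1.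
  exists (z 0 i); first by rewrite lt_neqAle eq_sym zi0; case/andP: (z0 i).
  move=> y yz yi0; have := le_lt_trans (normr_coord_le _ i) yz.
  by rewrite !mxE yi0 add0r normrN ltNge ler_norm.
- by exists r => // y yr i; apply: rP.
Qed.

End Simplex.

(** * Polyhedral functions *)

Section MaxAffine.
Variables (R : realType) (n : nat).
Implicit Types (u v w y z e : 'rV[R]_n) (c : R) (F : 'rV[R]_n -> R).

Definition max_affine (I : finType) (a : I -> 'rV[R]_n) (b : I -> R) F :=
  (forall i v, dotv (a i) v + b i <= F v) /\
  (forall v, exists i, F v = dotv (a i) v + b i).

Definition polyhedral F := exists (I : finType) a b, @max_affine I a b F.

Section Pieces.
Variables (I : finType) (a : I -> 'rV[R]_n) (b : I -> R) (F : 'rV[R]_n -> R).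
Hypothesis aF : max_affine a b F.

Definition active v : {set I} := [set i | F v == dotv (a i) v + b i].

Lemma activeP v i : reflect (F v = dotv (a i) v + b i) (i \in active v).
Proof. by rewrite inE; apply: eqP. Qed.

Lemma active_exists v : exists i, i \in active v.
Proof. by have [i Fi] := aF.2 v; exists i; apply/activeP. Qed.

Lemma active_ge y i v : i \in active y -> F y + dotv (a i) (v - y) <= F v.
Proof. by move=> /activeP ->; have := aF.1 i v; rewrite !dotvE; lra. Qed.

Lemma active_eq y v i :
  i \in active y -> i \in active v -> F v = F y + dotv (a i) (v - y).
Proof. by move=> /activeP -> /activeP ->; rewrite !dotvE; lra. Qed.

(** A piece inactive at [y] lies strictly below some active piece [j] there, and the gap stays open
    nearby. *)
Lemma active_near y : exists2 r : R, 0 < r &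
  forall v, enorm (v - y) < r -> active v \subset active y.
Proof.
have [|i|r r0 rP] := @common_radius R I
   (fun i r => forall v, enorm (v - y) < r -> i \in active v -> i \in active y).
- by move=> i r r' rr' + v vr; apply; exact: lt_le_trans rr'.
- case: (boolP (i \in active y)) => [_|]; first by exists 1.
  move=> /activeP iy; have [j jy] := active_exists y.
  have gap : 0 < F y - (dotv (a i) y + b i).
    by rewrite subr_gt0 lt_neqAle aF.1 andbT; apply/eqP => /esym.
  have q0 : 0 < enorm (a i - a j) + 1 by rewrite ltr_wpDl ?enorm_ge0.
  exists ((F y - (dotv (a i) y + b i)) / (enorm (a i - a j) + 1)).
    by rewrite divr_gt0.
  move=> v; rewrite ltr_pdivlMr // => vr /activeP iv.
  have := active_ge v jy; rewrite iv.
  have := dotv_le_enorm (a i - a j) (v - y); have := enorm_ge0 (v - y).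
  rewrite !dotvE; lra.
- by exists r => // v vr; apply/fintype.subsetP => i; apply: rP.
Qed.

End Pieces.

Lemma polyhedral_lipschitz F : polyhedral F ->
  exists2 C : R, 0 < C & forall u v, F u - F v <= C * enorm (u - v).
Proof.
move=> [I [a [b aF]]]; exists (1 + \sum_i enorm (a i)).
  by rewrite ltr_wpDr // sumr_ge0 // => i _; exact: enorm_ge0.
move=> u v; have [i iu] := active_exists aF u.
have := active_ge aF v iu; rewrite -(opprB u) dotvNr.
have := dotv_le_enorm (a i) (u - v); have := enorm_ge0 (u - v).
have : enorm (a i) <= \sum_i enorm (a i).
  by rewrite (bigD1 i) //= lerDl sumr_ge0 // => j _; exact: enorm_ge0.
nra.
Qed.

Lemma polyhedral_convex F y v c : polyhedral F -> 0 <= c <= 1 ->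
  F (y + c *: (v - y)) <= F y + c * (F v - F y).
Proof.
move=> [I [a [b aF]]] /andP[c0 c1].
have [i /activeP ->] := active_exists aF (y + c *: (v - y)).
have := aF.1 i y; have := aF.1 i v; rewrite !dotvE; nra.
Qed.

Lemma polyhedral_affine u c : polyhedral (fun v => dotv u v + c).
Proof. by exists unit, (fun=> u), (fun=> c); split=> // v; exists tt. Qed.

Lemma polyhedral_add F1 F2 :
  polyhedral F1 -> polyhedral F2 -> polyhedral (fun v => F1 v + F2 v).
Proof.
move=> [I [a [b [aF1 aF2]]]] [J [a' [b' [bF1 bF2]]]].
exists (I * J)%type, (fun k => a k.1 + a' k.2), (fun k => b k.1 + b' k.2).
split=> [[i j] v|v] /=.
  by rewrite dotvDl addrACA lerD.
have [i ->] := aF2 v; have [j ->] := bF2 v.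
by exists (i, j); rewrite dotvDl addrACA.
Qed.

Lemma polyhedral_scale F c : 0 <= c -> polyhedral F -> polyhedral (fun v => c * F v).
Proof.
move=> c0 [I [a [b [aF1 aF2]]]].
exists I, (fun i => c *: a i), (fun i => c * b i); split=> [i v|v].
  by rewrite dotvZl -mulrDr ler_wpM2l.
by have [i ->] := aF2 v; exists i; rewrite dotvZl mulrDr.
Qed.

Lemma polyhedral_max F1 F2 : polyhedral F1 -> polyhedral F2 ->
  polyhedral (fun v => Num.max (F1 v) (F2 v)).
Proof.
move=> [I [a [b [aF1 aF2]]]] [J [a' [b' [bF1 bF2]]]].
exists (I + J)%type,
  (fun k => match k with inl i => a i | inr j => a' j end),
  (fun k => match k with inl i => b i | inr j => b' j end).
split=> [[i|j] v|v] /=; rewrite ?le_max ?aF1 ?bF1 ?orbT //.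
have [i Fi] := aF2 v; have [j Fj] := bF2 v.
by case: (leP (F1 v) (F2 v)) => _; [exists (inr j)|exists (inl i)].
Qed.

Lemma eq_polyhedral F1 F2 : F1 =1 F2 -> polyhedral F1 -> polyhedral F2.
Proof. by move=> /funext ->. Qed.

(* The subdifferential of a max-affine function plus the indicator of [D]
   depends only on the active pieces and on the feasible directions. *)
Lemma subgrad_transfer (D : 'rV[R]_n -> Prop) (I : finType)
    (a : I -> 'rV[R]_n) (b : I -> R) F y z u :
  max_affine a b F -> active a b F z \subset active a b F y ->
  (forall v, D v -> exists2 r : R, 0 < r &
     forall c, 0 < c <= r -> D (z + c *: (v - y))) ->
  (forall v, D v -> F z + dotv u (v - z) <= F v) ->
  forall v, D v -> F y + dotv u (v - y) <= F v.
Proof.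
move=> aF zy shift uz v Dv; have [r r0 rP] := shift v Dv.
have [r' r'0 near] := active_near aF z.
have q0 : 0 < enorm (v - y) + 1 by rewrite ltr_wpDl ?enorm_ge0.
pose c := Num.min r (r' / (enorm (v - y) + 1)).
have c0 : 0 < c by rewrite lt_min r0 divr_gt0.
have cr : c <= r by rewrite ge_min lexx.
have cr' : enorm (z + c *: (v - y) - z) < r'.
  rewrite addrK_l enormZ gtr0_norm //.
  apply: (@lt_le_trans _ _ (c * (enorm (v - y) + 1))).
    by rewrite ltr_pM2l // ltrDl.
  by rewrite -ler_pdivlMr // ge_min lexx orbT.
have Dz : D (z + c *: (v - y)) by apply: rP; rewrite c0.
have [i iv] := active_exists aF (z + c *: (v - y)).
have iz := fintype.subsetP (near _ cr') _ iv.
(* The piece [i] is active at both [z] and the test point, so the inequality reduces to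
   [dotv u (v - y) <= dotv (a i) (v - y)]; and [i] is active at [y] as well. *)
have := uz _ Dz; rewrite (active_eq iz iv) addrK_l !dotvZr.
rewrite lerD2l ler_pM2l // => ui.
by have := active_ge aF v (fintype.subsetP zy _ iz); lra.
Qed.

(* [F] is affine on the line from [z] through [y], slightly beyond [y], which makes
   the subgradient inequality tight at [z]. *)
Lemma subgrad_extrapolate (I : finType) (a : I -> 'rV[R]_n) (b : I -> R) F y z u :
  max_affine a b F -> active a b F y \subset active a b F z ->
  (forall v, F y + dotv u (v - y) <= F v) -> F z <= F y + dotv u (z - y).
Proof.
move=> aF yz uy; have [r r0 near] := active_near aF y.
have q0 : 0 < enorm (y - z) + 1 by rewrite ltr_wpDl ?enorm_ge0.
pose c := r / (enorm (y - z) + 1); have c0 : 0 < c by rewrite divr_gt0.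
have cr : enorm (y + c *: (y - z) - y) < r.
  rewrite addrK_l enormZ gtr0_norm //.
  apply: (@lt_le_trans _ _ (c * (enorm (y - z) + 1))).
    by rewrite ltr_pM2l // ltrDl.
  by rewrite divfK // gt_eqF.
have [i iv] := active_exists aF (y + c *: (y - z)).
have iy := fintype.subsetP (near _ cr) _ iv.
have := uy (y + c *: (y - z)); rewrite (active_eq iy iv) addrK_l !dotvZr.
rewrite lerD2l ler_pM2l // (active_eq (fintype.subsetP yz _ iy) iy) -(opprB y).
by rewrite dotvNr; lra.
Qed.

End MaxAffine.

(** * CVaR is polyhedral *)

Section Tail.
Variables (R : realType) (S : nat) (p : 'I_S -> R) (a : R).
Hypothesis p_ge0 : forall j, 0 <= p j.
Implicit Types (B : {set 'I_S}) (i j : 'I_S) (c : 'I_S -> R).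

(* [tail_weight B i] puts the full mass [p] on [B] and the rest of the mass [a]
   on [i]; these are the vertices of [{q | 0 <= q <= p, \sum_j q j = a}]. *)
Definition tail_weight B i j : R :=
  if j \in B then p j else if j == i then a - \sum_(l in B) p l else 0.

Definition tail_ok (Bi : {set 'I_S} * 'I_S) : bool :=
  (Bi.2 \notin Bi.1) && (0 <= a - \sum_(l in Bi.1) p l <= p Bi.2).

Lemma sum_tail_weight B i c : i \notin B ->
  \sum_j tail_weight B i j * c j =
  \sum_(j in B) p j * c j + (a - \sum_(l in B) p l) * c i.
Proof.
move=> iB; rewrite (bigID (mem B)) /=; congr (_ + _).
  by apply: eq_bigr => j jB; rewrite /tail_weight jB.
rewrite (bigD1 i) //= {1}/tail_weight (negbTE iB) eqxx [X in _ + X]big1 ?addr0 // => j.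
by case/andP=> /negbTE jB /negbTE ji; rewrite /tail_weight jB ji mul0r.
Qed.

Lemma tail_weight_bounds B i j : tail_ok (B, i) ->
  0 <= tail_weight B i j <= p j.
Proof.
case/andP=> /= _ ok; rewrite /tail_weight.
case: ifP => _; first by rewrite lexx p_ge0.
by case: eqP => [->|_] //; rewrite lexx p_ge0.
Qed.

Lemma tail_weight_sum1 B i : i \notin B -> \sum_j tail_weight B i j = a.
Proof.
move=> iB; have := sum_tail_weight (fun=> 1) iB.
under eq_bigr do rewrite mulr1.
by under [X in _ = X + _]eq_bigr do rewrite mulr1; rewrite mulr1 addrC subrK.
Qed.

(** Exchange argument: both weights have total mass [a], so [c i] may be subtracted from every cost.
    The first weight is then full where the reduced cost is nonpositive, and vanishes off [B] except
    at [i], where that cost is 0. *)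
Lemma tail_weight_min B i B' i' c : tail_ok (B, i) -> tail_ok (B', i') ->
  (forall j, j \in B -> c j <= c i) -> (forall j, j \notin B -> c i <= c j) ->
  \sum_j tail_weight B i j * c j <= \sum_j tail_weight B' i' j * c j.
Proof.
move=> ok ok' cB cNB; have /andP[/= iB _] := ok; have /andP[/= iB' _] := ok'.
rewrite -subr_ge0.
have -> : \sum_j tail_weight B' i' j * c j - \sum_j tail_weight B i j * c j =
    \sum_j (tail_weight B' i' j - tail_weight B i j) * (c j - c i).
  under [RHS]eq_bigr do rewrite mulrBr !mulrBl.
  by rewrite !sumrB -!mulr_suml !tail_weight_sum1 // subrr subr0.
apply: sumr_ge0 => j _; have /andP[q0 qp] := tail_weight_bounds j ok'.
rewrite {2}/tail_weight; case: ifPn => jB.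
  by have := cB j jB; nra.
case: eqP => [->|_]; first by rewrite subrr mulr0.
by rewrite subr0 mulr_ge0 // subr_ge0 cNB.
Qed.

End Tail.

Section CVaRPolyhedral.
Variables (R : realType) (n S : nat) (x : 'I_S -> 'rV[R]_n) (p : 'I_S -> R) (a : R).
Hypotheses (p01 : forall j, 0 <= p j <= 1) (p1 : \sum_(j < S) p j = 1).
Hypothesis a01 : 0 < a < 1.

Let order w : seq 'I_S :=
  sort (fun i j : 'I_S => dotv w (x i) <= dotv w (x j)) (enum 'I_S).

Lemma cum_probE w m : cum_prob x p w m = \sum_(j <- take m (order w)) p j.
Proof. by rewrite /cum_prob /sorted_scen -map_take big_map. Qed.

Lemma cum_prob_ge0 w m : 0 <= cum_prob x p w m.
Proof. by rewrite cum_probE sumr_ge0 // => j _; case/andP: (p01 j). Qed.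

(** [m = 0] qualifies since [0 < a], so the maximum is attained; [m = S] does not, since the total
    mass is [1 > a]. Hence a scenario exists at the zero-based position [k]. *)
Lemma cvar_kP w : [/\ (cvar_k x p a w < S)%N,
  cum_prob x p w (cvar_k x p a w) < a &
  a <= cum_prob x p w (cvar_k x p a w).+1].
Proof.
have /andP[a0 a1] := a01.
have c0 : cum_prob x p w 0 < a by rewrite cum_probE take0 big_nil.
have cS : cum_prob x p w S = 1.
  rewrite cum_probE take_oversize ?size_sort ?size_enum_ord //.
  by rewrite -[RHS]p1 (perm_big (enum 'I_S)) ?perm_sort // big_enum.
have [m mA mE] : {m : 'I_S.+1 | cum_prob x p w m < a & cvar_k x p a w = m}.
  by apply: eq_bigmax_cond; apply/card_gt0P; exists ord0.
have mS : (m < S)%N.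
  rewrite ltn_neqAle -ltnS ltn_ord andbT; apply/eqP => mS.
  by move: mA; rewrite mS cS; lra.
rewrite mE; split=> //; rewrite leNgt; apply/negP => mA'.
have : (m.+1 <= cvar_k x p a w)%N.
  by apply: (leq_bigmax_cond (Ordinal (mS : m.+1 < S.+1)%N)).
by rewrite mE ltnn.
Qed.

Let tail_piece (Bi : {set 'I_S} * 'I_S) : 'rV[R]_n :=
  - \sum_j tail_weight p a Bi.1 Bi.2 j *: x j.

Lemma dotv_tail_piece Bi w : dotv (tail_piece Bi) w =
  - \sum_j tail_weight p a Bi.1 Bi.2 j * dotv w (x j).
Proof.
rewrite dotvNl dotv_suml; congr (- _); apply: eq_bigr => j _.
by rewrite dotvZl dotvC.
Qed.

(** The vertex takes for [B] the first [k] scenarios in sorted order and for [i] the next one. *)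
Lemma CVaR_attained w : exists Bi, [/\ tail_ok p a Bi,
  forall j, j \in Bi.1 -> dotv w (x j) <= dotv w (x Bi.2),
  forall j, j \notin Bi.1 -> dotv w (x Bi.2) <= dotv w (x j) &
  a * CVaR x p a w = \sum_j tail_weight p a Bi.1 Bi.2 j * dotv w (x j)].
Proof.
have [kS cka ack] := cvar_kP w; set k := cvar_k x p a w in kS cka ack *.
have i0 : 'I_S := Ordinal kS.
pose B := [set j in take k (order w)]; pose i := nth i0 (order w) k.
have szs : size (order w) = S by rewrite size_sort size_enum_ord.
have us : uniq (order w) by rewrite sort_uniq enum_uniq.
have ms j : j \in order w by rewrite mem_sort mem_enum.
have sumB (f : 'I_S -> R) : \sum_(j in B) f j = \sum_(j <- take k (order w)) f j.
  by rewrite big_uniq ?take_uniq //; apply: eq_bigl => j; rewrite inE.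
have BE j : (j \in B) = (index j (order w) < k)%N.
  by rewrite inE in_take.
have iE : index i (order w) = k by rewrite index_uniq ?szs.
have mono j l : (index j (order w) <= index l (order w))%N ->
    dotv w (x j) <= dotv w (x l).
  move=> jl; rewrite -[j](nth_index i0 (ms j)) -[l](nth_index i0 (ms l)).
  have tr : transitive (fun i j : 'I_S => dotv w (x i) <= dotv w (x j)).
    by move=> ? ? ?; exact: le_trans.
  apply: (sorted_leq_nth tr); rewrite ?inE ?index_mem //.
  by apply: sort_sorted => ? ?; exact: le_total.
have iB : i \notin B by rewrite BE iE ltnn.
have cumS : cum_prob x p w k.+1 = cum_prob x p w k + p i.
  by rewrite !cum_probE (take_nth i0) ?szs // -cats1 big_cat big_seq1.
exists (B, i); split=> /=.
- by rewrite /tail_ok iB /= sumB -cum_probE; rewrite cumS in ack; lra.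
- by move=> j jB; apply: mono; rewrite iE ltnW // -BE.
- by move=> j jB; apply: mono; rewrite iE leqNgt -BE.
- rewrite sum_tail_weight // !sumB -cum_probE /CVaR /cvar_eps -/k.
  have a0 : a != 0 by rewrite gt_eqF //; case/andP: a01.
  rewrite /sorted_scen -map_take big_map (nth_map i0) ?szs //= -/(order w) -/i.
  by field.
Qed.

(** Negation turns the minimum over the vertices into a maximum of finitely many linear
    functions. *)
Lemma polyhedral_CVaR : polyhedral (fun w => - (a * CVaR x p a w)).
Proof.
have p0 j : 0 <= p j by case/andP: (p01 j).
exists {Bi | tail_ok p a Bi}, (fun Bi => tail_piece (val Bi)), (fun=> 0).
split=> [[[B i] ok] w|w] /=.
  have [[B' i'] [ok' h1 h2 ->]] := CVaR_attained w.
  by rewrite dotv_tail_piece addr0 lerN2; apply: tail_weight_min.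
have [Bi [ok _ _ ->]] := CVaR_attained w.
by exists (exist _ Bi ok); rewrite addr0 dotv_tail_piece.
Qed.

End CVaRPolyhedral.

(** * Points of differentiability of polyhedral functions *)

Definition locally_affine (R : realType) n (F : 'rV[R]_n -> R) z l : Prop :=
  exists2 r : R, 0 < r & forall v, enorm (v - z) < r -> F v = F z + dotv l (v - z).

(* A nonsmooth kink of [F] cannot be compensated by the smooth quadratic term,
   so at a point of differentiability all active pieces have the same slope. *)
Lemma locally_affine_of_differentiable (R : realType) n (F : 'rV[R]_n -> R)
    (c : R) (z : 'rV[R]_n) :
  polyhedral F -> differentiable (fun v => c * enorm v ^+ 2 + F v) z ->
  exists l, locally_affine F z l.
Proof.
move=> [I [a [b aF]]] dF; set Q := (fun v => _) in dF.
(* An active piece bounds [Q] from below along [e] up to a quadratic error; approaching [z] from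
   both sides bounds the derivative from both sides. *)
have slope i e : i \in active a b F z ->
    'D_e Q z = dotv (2 * c *: z + a i) e.
  move=> iz; have De : derivable Q z e by exact: diff_derivable.
  have QE h : h * dotv (2 * c *: z + a i) e <=
      Q (h *: e + z) - Q z - h ^+ 2 * (c * dotv e e).
    have := active_ge aF (h *: e + z) iz; rewrite addrK.
    by rewrite /Q !sqr_enorm !dotvE (dotvC z e); lra.
  have lim eps : 0 < eps -> exists2 r : R, 0 < r & forall h, h != 0 -> `|h| < r ->
      `|h^-1 * (Q (h *: e + z) - Q z) - 'D_e Q z| < eps.
    move=> eps0; move/cvgrPdist_lt : De => /(_ eps eps0).
    case=> r /= r0 rP; exists r => // h h0 hr.
    by rewrite distrC; apply: rP => //=; rewrite sub0r normrN.
  set D := 'D_e Q z in lim *; set A := dotv _ _ in QE *.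
  set B := c * dotv e e in QE.
  have small (eps : R) : 0 < eps -> exists t, [/\ 0 < t, - eps <= t * B <= eps,
      `|t^-1 * (Q (t *: e + z) - Q z) - D| < eps &
      `|(- t)^-1 * (Q (- t *: e + z) - Q z) - D| < eps].
    move=> eps0; have [r r0 rP] := lim eps eps0.
    have B1 : 0 < `|B| + 1 by rewrite ltr_wpDl.
    exists (Num.min (r / 2) (eps / (`|B| + 1))); set t := Num.min _ _.
    have t0 : 0 < t by rewrite lt_min !divr_gt0.
    have tr : t < r.
      by apply: (@le_lt_trans _ _ (r / 2)); [rewrite ge_min lexx|lra].
    split=> //; last 2 first.
    - by apply: rP; rewrite ?gt_eqF ?gtr0_norm.
    - by apply: rP; rewrite ?oppr_eq0 ?gt_eqF ?normrN ?gtr0_norm.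
    rewrite -ler_norml normrM (gtr0_norm t0).
    apply: (@le_trans _ _ (t * (`|B| + 1))).
      by rewrite ler_pM2l // lerDl.
    by rewrite -ler_pdivlMr // ge_min lexx orbT.
  apply/eqP; rewrite eq_le; apply/andP; split; rewrite leNgt; apply/negP => lt.
    have [|t [t0 /andP[tB1 tB2] _]] := small ((D - A) / 2); first lra.
    have := QE (- t); rewrite sqrrN; set X := Q _ - Q z => hX.
    rewrite ltr_norml => /andP[+ _]; set q := _^-1 * X => qD.
    have XE : X = - t * q by rewrite mulVKf // oppr_eq0 gt_eqF.
    have : t * q <= t * (A - t * B) by rewrite XE in hX; lra.
    by rewrite ler_pM2l //; lra.
  have [|t [t0 /andP[tB1 tB2] + _]] := small ((A - D) / 2); first lra.
  have := QE t; set X := Q _ - Q z => hX.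
  rewrite ltr_norml => /andP[_]; set q := _^-1 * X => qD.
  have XE : X = t * q by rewrite mulVKf // gt_eqF.
  have : t * (A + t * B) <= t * q by rewrite XE in hX; lra.
  by rewrite ler_pM2l //; lra.
(* All slopes active at [z] agree in every direction, so near [z] any active piece can be replaced
   by piece [i]. *)
have [i iz] := active_exists aF z; exists (a i).
have [r r0 near] := active_near aF z; exists r => // v vr.
have [j jv] := active_exists aF v; have jz := fintype.subsetP (near v vr) j jv.
rewrite (active_eq jz jv); congr (_ + _).
by have := slope i (v - z) iz; rewrite (slope j) // !dotvE; lra.
Qed.

(** * Rates *)

Lemma frequently_pigeonhole (T : finType) (Q : nat -> Prop) (f : nat -> T) :
  (forall N, exists2 k, (N <= k)%N & Q k) ->
  exists t, forall N, exists2 k, (N <= k)%N & Q k /\ f k = t.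
Proof.
move=> Qfreq; apply: contrapT => /forallNP nt.
have /choice [N NP] t : exists N, forall k, (N <= k)%N -> ~ (Q k /\ f k = t).
  have /existsNP [N nN] := nt t.
  by exists N => k Nk QF; apply: nN; exists k.
have [k Nk Qk] := Qfreq (\max_t N t)%N.
by apply: (NP (f k) k) => //; apply: leq_trans Nk; apply: leq_bigmax.
Qed.

(** Even and odd indices contract separately; the two summands of the constant cover the starting
    values [L 0] and [L 1]. *)
Lemma geometric_of_two_step (R : realType) (q : R) (L : nat -> R) :
  0 < q -> 0 <= L 0%N -> 0 <= L 1%N ->
  (forall i, L i.+2 <= q ^+ 2 * L i) ->
  forall i, L i <= (L 0%N + L 1%N / q) * q ^+ i.
Proof.
move=> q0 L0 L1 hL i; set C := _ + _.
suff [] : L i <= C * q ^+ i /\ L i.+1 <= C * q ^+ i.+1 by [].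
elim: i => [|i [h1 h2]]; split => //.
- by rewrite expr0 mulr1 lerDl divr_ge0 // ltW.
- by rewrite expr1 /C mulrDl divfK ?gt_eqF // lerDr mulr_ge0 // ltW.
- apply: le_trans (hL i) _; rewrite -[i.+2]addn2 exprD mulrA [leRHS]mulrC.
  by apply: ler_wpM2l; rewrite ?sqr_ge0.
Qed.

(** The index shift costs a factor [q ^- N], and the sum of [L k / q ^+ k] over [k < N] covers the
    first terms. *)
Lemma linear_rate_of_tail (R : realType) (q C : R) (L : nat -> R) N :
  0 < q -> 0 <= C -> (forall k, 0 <= L k) ->
  (forall i, L (N + i)%N <= C * q ^+ i) ->
  exists2 C', 0 <= C' & forall k, L k <= C' * q ^+ k.
Proof.
move=> q0 C0 L0 hL.
have D0 : 0 <= \sum_(k < N) L k / q ^+ k.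
  by apply: sumr_ge0 => k _; rewrite divr_ge0 // exprn_ge0 // ltW.
have CN : 0 <= C / q ^+ N by rewrite divr_ge0 // exprn_ge0 // ltW.
exists (C / q ^+ N + \sum_(k < N) L k / q ^+ k); first exact: addr_ge0.
move=> k; rewrite mulrDl; have [Nk|kN] := leqP N k.
  rewrite -(subnKC Nk); apply: ler_wpDr.
    by rewrite mulr_ge0 // exprn_ge0 // ltW.
  by rewrite exprD mulrA divfK ?expf_neq0 ?gt_eqF.
apply: ler_wpDl; first by rewrite mulr_ge0 // exprn_ge0 // ltW.
rewrite -ler_pdivrMr ?exprn_gt0 // (bigD1 (Ordinal kN)) //= lerDl.
by apply: sumr_ge0 => j _; rewrite divr_ge0 // exprn_ge0 // ltW.
Qed.

Lemma linear_rate_of_eventually_eq (R : realType) n (w : nat -> 'rV[R]_n) wbar N :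
  (forall k, (N <= k)%N -> w k = wbar) ->
  exists C q : R, 0 <= C /\ 0 < q < 1 /\
    forall k, enorm (w k - wbar) <= C * q ^+ k.
Proof.
move=> wN; have q0 : 0 < 1 / 2 :> R by lra.
have [j|i|C C0 hC] := @linear_rate_of_tail R (1 / 2) 0
  (fun j => enorm (w j - wbar)) N q0 (lexx 0); first exact: enorm_ge0.
  by rewrite wN ?leq_addr // subrr enorm0 mul0r.
by exists C, (1 / 2); split=> //; split=> //; lra.
Qed.

(* [A], [B], [C] are the step lengths of three consecutive overshooting steps
   through a common point, and [A0], [C0] the maximal feasible ones on the same
   side of it.  Were no further backtracking used for [C] than for [A], the
   third step would overshoot farther than the first one. *)
Lemma overshoot_contraction (R : realType) (beta A0 C0 A B C : R) (i j : nat) :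
  0 < beta < 1 -> 1 < A -> 1 < B -> 1 < C ->
  A = beta ^+ i * A0 -> C = beta ^+ j * C0 ->
  A0 - 1 = (A - 1) * (B - 1) * (C0 - 1) ->
  (A - 1) * (B - 1) < 1 -> (B - 1) * (C - 1) < 1 ->
  (A - 1) * (B - 1) * C <= beta * A.
Proof.
move=> /andP[b0 b1] A1 B1 C1 AE CE AC; set k := _ * (B - 1) => k1 BC.
have k0 : 0 < k by rewrite mulr_gt0 ?subr_gt0.
have bi : 0 < beta ^+ i <= 1 by rewrite exprn_gt0 // exprn_ile1 // ltW.
have bj : 0 < beta ^+ j <= 1 by rewrite exprn_gt0 // exprn_ile1 // ltW.
have kC0 : k * C0 = A0 - 1 + k by rewrite AC -/k; ring.
have kC : k * C = beta ^+ j * (A0 - 1 + k) by rewrite CE -kC0; ring.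
have A0_gt1 : 1 < A0.
  move: bi => /andP[bi0 bi1]; rewrite ltNge; apply/negP => h.
  by have := A1; rewrite AE; nra.
have overshoot : (C - 1) * k < A - 1.
  by rewrite /k mulrC -mulrA gtr_pMr // subr_gt0.
(* If [j <= i], then [k * C >= A - beta ^+ i * (1 - k) >= A - (1 - k)], against [overshoot]. *)
have ij : (i < j)%N.
  rewrite ltnNge; apply/negP => ji.
  have bij : beta ^+ i <= beta ^+ j by rewrite ler_wiXn2l // ltW.
  have : beta ^+ i * (A0 - 1 + k) <= k * C.
    by rewrite kC ler_wpM2r //; lra.
  by move: bi => /andP[bi0 bi1]; move: overshoot; rewrite AE; nra.
rewrite kC AE mulrA -exprS; apply: ler_pM.
- by case/andP: bj => /ltW.
- lra.
- by rewrite ler_wiXn2l // ltW.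
- lra.
Qed.

(** * The boosted DC iteration *)

Section BoostedDC.
Variables (R : realType) (n : nat) (G H : 'rV[R]_n -> R) (rho beta : R).
Variables (w y u : nat -> 'rV[R]_n) (lam : nat -> R) (wbar : 'rV[R]_n).

Let phi v := G v - H v.

Hypotheses (polyG : polyhedral G) (polyH : polyhedral H).
Hypotheses (rho_gt0 : 0 < rho) (beta01 : 0 < beta < 1).
Hypothesis sub_u : forall k v,
  rho / 2 * enorm (w k) ^+ 2 + H (w k) + dotv (u k) (v - w k) <=
  rho / 2 * enorm v ^+ 2 + H v.
Hypothesis simplex_y : forall k, simplex (y k).
Hypothesis min_y : forall k v, simplex v ->
  rho / 2 * enorm (y k) ^+ 2 + G (y k) - dotv (y k) (u k) <=
  rho / 2 * enorm v ^+ 2 + G v - dotv v (u k).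
Hypothesis simplex_w : forall k, simplex (w k).
Hypothesis lam_ge1 : forall k, 1 <= lam k.
Hypothesis w_step : forall k, w k.+1 = w k + lam k *: (y k - w k).
Hypothesis armijo : forall k,
  phi (w k.+1) <= phi (w k) - rho * enorm (w k.+1 - w k) ^+ 2.
Hypothesis simplex_wbar : simplex wbar.
Hypothesis wbar_limit : forall e : R, 0 < e ->
  forall N, exists2 k, (N <= k)%N & enorm (w k - wbar) < e.

Lemma phi_nonincreasing k m : (k <= m)%N -> phi (w m) <= phi (w k).
Proof.
move=> /subnKC <-; elim: (m - k)%N => [|i IH]; first by rewrite addn0.
rewrite addnS; apply: le_trans IH; apply: le_trans (armijo _) _.
by rewrite gerBl mulr_ge0 ?sqr_ge0 // ltW.
Qed.

Lemma phi_lipschitz :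
  exists2 C : R, 0 < C & forall v v', phi v - phi v' <= C * enorm (v - v').
Proof.
have [C C0 hC] := polyhedral_lipschitz polyG.
have [C' C'0 hC'] := polyhedral_lipschitz polyH.
exists (C + C'); first exact: addr_gt0.
by move=> v v'; have := hC v v'; have := hC' v' v; rewrite enormB /phi; lra.
Qed.

(** Later iterates have values at most [phi (w k)] and come arbitrarily close to [wbar], where [phi]
    is continuous. *)
Lemma phi_ge_limit k : phi wbar <= phi (w k).
Proof.
have [C C0 hC] := phi_lipschitz; rewrite leNgt; apply/negP => lt.
have [|m km] := wbar_limit (_ : 0 < (phi wbar - phi (w k)) / C) k.
  by rewrite divr_gt0 // subr_gt0.
rewrite ltr_pdivlMr // enormB mulrC => wm.
by have := phi_nonincreasing km; have := hC wbar (w m); lra.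
Qed.

Lemma phi_cvg e : 0 < e -> exists N, forall k, (N <= k)%N -> phi (w k) < phi wbar + e.
Proof.
move=> e0; have [C C0 hC] := phi_lipschitz.
have [N _ wN] := wbar_limit (divr_gt0 e0 C0) 0%N.
exists N => k Nk; move: wN; rewrite ltr_pdivlMr // mulrC.
by have := phi_nonincreasing Nk; have := hC (w N) wbar; lra.
Qed.

Lemma enorm_direction_le k : enorm (y k - w k) <= enorm (w k.+1 - w k).
Proof.
rewrite w_step addrK_l enormZ ger0_norm ?(le_trans ler01) //.
by rewrite ler_peMl ?enorm_ge0.
Qed.

(** The Armijo test bounds [rho] times the squared step by the decrease of [phi], which is
    eventually below [rho * e ^+ 2]. *)
Lemma small_steps e : 0 < e -> exists N, forall k, (N <= k)%N ->
  enorm (w k.+1 - w k) < e /\ enorm (y k - w k) < e.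
Proof.
move=> e0; have [N NP] := phi_cvg (mulr_gt0 rho_gt0 (exprn_gt0 2 e0)).
exists N => k Nk; suff h : enorm (w k.+1 - w k) < e.
  by split=> //; apply: le_lt_trans h; exact: enorm_direction_le.
rewrite -(@ltr_pXn2r _ 2) ?nnegrE ?enorm_ge0 ?ltW //.
rewrite -(ltr_pM2l rho_gt0).
by have := NP k Nk; have := phi_ge_limit k.+1; have := armijo k; lra.
Qed.

(** No decrease is left below the level [phi wbar], so the Armijo test forces zero steps, and a
    constant sequence equals its limit point. *)
Lemma stationary_of_phi_le k : phi (w k) <= phi wbar ->
  forall m, (k <= m)%N -> w m = wbar.
Proof.
move=> le_phi.
have const m : (k <= m)%N -> w m = w k.
  move=> /subnKC <-; elim: (m - k)%N => [|i IH]; first by rewrite addn0.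
  rewrite addnS -IH; apply/eqP; rewrite -subr_eq0; apply/eqP/dotvv_eq0.
  rewrite -sqr_enorm -(pmulr_rle0 _ rho_gt0).
  have := armijo (k + i); have := phi_nonincreasing (leq_addr i k).
  by have := phi_ge_limit (k + i).+1; lra.
move=> m km; rewrite (const m km); apply/eqP; rewrite -subr_eq0.
apply/negPn/negP => /enorm_gt0 pos; have [j kj] := wbar_limit pos k.
by rewrite (const j kj) ltxx.
Qed.

(** The quadratic term contributes its gradient [rho *: w k]; its remainder along a segment is of
    second order. *)
Lemma subgradH k v : H (w k) + dotv (u k - rho *: w k) (v - w k) <= H v.
Proof.
suff : H (w k) + dotv (u k - rho *: w k) (v - w k) - H v <= 0 by lra.
apply: (@le0_of_le_quadratic _ _ (rho / 2 * dotv (v - w k) (v - w k)) 1) => //.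
move=> s /andP[s0 s1].
have := @polyhedral_convex _ _ H (w k) v s polyH; rewrite (ltW s0) s1 => /(_ isT).
have := sub_u k (w k + s *: (v - w k)).
by rewrite addrK_l !sqr_enorm !dotvE !(dotvC v (w k)); lra.
Qed.

(** * Smooth [g]: finite termination *)

Section SmoothG.
Variable l : 'rV[R]_n.
Hypothesis affG : locally_affine G wbar l.

Lemma finite_termination_smoothG : exists N, forall k, (N <= k)%N -> w k = wbar.
Proof.
have [r r0 rG] := affG; have [I [a [b aH]]] := polyH.
have [r' r'0 rH] := active_near aH wbar.
(* Halving leaves room for one step: [w k] within [s] of [wbar] and a step shorter than [s] keep
   [y k] and [w k.+1] within [r]. *)
pose s := Num.min r r' / 2.
have [s0 sr sr'] : [/\ 0 < s, s + s <= r & s <= r'].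
  have : 0 < Num.min r r' by rewrite lt_min r0.
  have : Num.min r r' <= r by rewrite ge_min lexx.
  have : Num.min r r' <= r' by rewrite ge_min lexx orbT.
  by rewrite /s; split; lra.
have [N0 small] := small_steps s0.
(* First-order optimality of [y k] on the simplex, with [l] the gradient of [G] around [y k]. *)
have normal k : (N0 <= k)%N -> enorm (w k - wbar) < s -> forall v, simplex v ->
    dotv (u k - l - rho *: y k) (v - y k) <= 0.
  move=> Nk wk v sv; have [_ dk] := small k Nk.
  have yk : enorm (y k - wbar) < r.
    by have := enorm_triangle (w k) (y k) wbar; lra.
  have q0 : 0 < enorm (v - y k) + 1 by rewrite ltr_wpDl ?enorm_ge0.
  pose t0 := Num.min 1 ((r - enorm (y k - wbar)) / (enorm (v - y k) + 1)).
  have t0_gt0 : 0 < t0 by rewrite lt_min ltr01 divr_gt0 // subr_gt0.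
  apply: (@le0_of_le_quadratic _ _ (rho / 2 * dotv (v - y k) (v - y k)) t0) => //.
  move=> t /andP[t_gt0]; rewrite le_min => /andP[t1].
  rewrite ler_pdivlMr // => tr.
  have st : simplex (y k + t *: (v - y k)).
    by apply: simplex_segment; rewrite // (ltW t_gt0).
  have yt : enorm (y k + t *: (v - y k) - wbar) < r.
    rewrite addrAC; apply: le_lt_trans (enormD _ _) _.
    by rewrite enormZ gtr0_norm //; lra.
  have := min_y k st; rewrite (rG _ yk) (rG _ yt) !sqr_enorm.
  rewrite !dotvE !(dotvC v (y k)) !(dotvC _ (u k)); lra.
(* The type of an iterate is the active set of [H] at [w k] with the zero set of [y k]; one type
   recurs forever near [wbar]. *)
have [t tP] := @frequently_pigeonhole ({set I} * {set 'I_n})%type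
  (fun k => (N0 <= k)%N /\ enorm (w k - wbar) < s)
  (fun k => (active a b H (w k), [set i | y k 0 i == 0]%SET))
  (fun N => let: ex_intro2 k Nk wk := wbar_limit s0 (maxn N N0) in
     ex_intro2 _ _ k (leq_trans (leq_maxl _ _) Nk)
       (conj (leq_trans (leq_maxr _ _) Nk) wk)).
have [k _ [[Nk wk] kt]] := tP 0%N; exists k.+1.
apply: stationary_of_phi_le; apply/ler_addgt0Pr => e e0.
pose z := w k.+1 - wbar.
(* With this scale, a later [y j - w j] is so short that its pairing with [rho *: z] is at most
   [e]. *)
have q0 : 0 < rho * (enorm z + 1) by rewrite mulr_gt0 // ltr_wpDl ?enorm_ge0.
have [N1 small1] := small_steps (divr_gt0 e0 q0).
have [j Nj [[N0j wj] jt]] := tP N1; have [_ dj] := small1 j Nj.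
have [activeE zeroE] : active a b H (w j) = active a b H (w k) /\
    [set i | y j 0 i == 0]%SET = [set i | y k 0 i == 0]%SET.
  by move: jt; rewrite -kt => -[].
have subj v : H (w k) + dotv (u j - rho *: w j) (v - w k) <= H v.
  apply: (subgrad_transfer (D := fun=> True) aH (z := w j)) => //.
  - by rewrite activeE.
  - by move=> v' _; exists 1.
  - by move=> v' _; exact: subgradH.
(* The normal cone is the subdifferential of the zero function, whose single piece is always active,
   plus the indicator of the simplex. *)
have norj v : simplex v -> dotv (u j - l - rho *: y j) (v - y k) <= 0.
  move=> sv; rewrite -[leLHS]add0r.
  apply: (@subgrad_transfer _ _ (@simplex R n) unit (fun=> 0) (fun=> 0) (fun=> 0)
    (y k) (y j)) => //.
  - by split=> [i v'|v']; [|exists tt]; rewrite dot0v addr0.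
  - by apply/fintype.subsetP => i _; apply/activeP; rewrite dot0v addr0.
  - move=> v' sv'; apply: simplex_shift => // i yji.
    have : i \in [set i | y j 0 i == 0]%SET by rewrite inE yji.
    by rewrite zeroE inE => /eqP.
  - by move=> v' sv'; rewrite add0r normal.
have [sk dk] := small k Nk.
have wk1 : enorm (w k.+1 - wbar) < r.
  by have := enorm_triangle (w k) (w k.+1) wbar; lra.
(* Pieces active at [w k] are active at [wbar], which reverses the subgradient inequality there. *)
have HE : H wbar <= H (w k) + dotv (u j - rho *: w j) (wbar - w k).
  apply: (@subgrad_extrapolate _ _ I a b) => //.
  by apply: rH; lra.
have n1 := norj wbar simplex_wbar; have n2 := norj (w k) (simplex_w k).
have n3 := subj (w k.+1).
have dz : - (rho * dotv (y j - w j) z) <= e.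
  have := normr_dotv_le (y j - w j) z; rewrite ler_norml => /andP[+ _].
  move: dj; rewrite ltr_pdivlMr //.
  have := enorm_ge0 (y j - w j); have := enorm_ge0 z; nra.
(* The test points [wbar] and [w k] in [norj] control the two parts of [z]: the move from [wbar] to
   [y k], and the overshoot beyond [y k]. *)
have zE : z = y k - wbar + (lam k - 1) *: (y k - w k).
  by apply/matrixP => i0 j0; rewrite /z w_step !mxE; ring.
have n2' : 0 <= (lam k - 1) * dotv (u j - l - rho *: y j) (w k - y k) * -1.
  by have := lam_ge1 k; nra.
rewrite /phi (rG _ wk1).
(* The left vector is minus the normal vector minus [rho *: (y j - w j)]; by [n3] and [HE] its
   pairing with [z] bounds [phi (w k.+1) - phi wbar]. *)
have n4 : dotv (l - (u j - rho *: w j)) z <= - (rho * dotv (y j - w j) z).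
  by rewrite zE; move: n1 n2'; rewrite !dotvE; nra.
move: n3 n4 dz HE; rewrite /z !dotvE; lra.
Qed.

End SmoothG.

(** * Smooth [h]: linear rate *)

Section SmoothH.
Variable l : 'rV[R]_n.
Hypothesis affH : locally_affine H wbar l.
Hypothesis backtracking : forall k, lam k = 1 \/ exists i lam0,
  [/\ lam k = beta ^+ i * lam0, simplex (w k + lam0 *: (y k - w k)) &
      forall c, simplex (w k + c *: (y k - w k)) -> c <= lam0].

(** Convex, and equal to [phi] up to a constant near [wbar], where [H] has slope [l]. *)
Let F v := G v + dotv (- l) v.

Lemma polyhedral_F : polyhedral F.
Proof.
apply: polyhedral_add => //.
by apply: eq_polyhedral (polyhedral_affine (- l) 0) => v; rewrite addr0.
Qed.

(* Near [wbar] the function [h] is the quadratic term plus an affine function, so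
   that [y k] is a proximal point of [F] at [w k]. *)
Lemma proximal_step : exists2 r : R, 0 < r &
  forall k, enorm (w k - wbar) < r -> forall v, simplex v ->
    F (y k) + rho * dotv (w k - y k) (v - y k) <= F v.
Proof.
have [r r0 rH] := affH; exists r => // k wk.
(* Where [H] is affine its subgradient is unique: test the inequality a small step along the
   difference [e]. *)
have uE : u k = rho *: w k + l.
  apply/eqP; rewrite -subr_eq0; set e := _ - _; apply/eqP/dotvv_eq0.
  have q0 : 0 < enorm e + 1 by rewrite ltr_wpDl ?enorm_ge0.
  have [c c0 cE] : exists2 c, 0 < c & c * (enorm e + 1) = r - enorm (w k - wbar).
    exists ((r - enorm (w k - wbar)) / (enorm e + 1)).
      by rewrite divr_gt0 // subr_gt0.
    by rewrite divfK // gt_eqF.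
  have we : enorm (w k + c *: e - wbar) < r.
    rewrite addrAC; apply: le_lt_trans (enormD _ _) _.
    by rewrite enormZ gtr0_norm //; lra.
  have := subgradH k (w k + c *: e); rewrite addrK_l (rH _ wk) (rH _ we).
  rewrite [w k + _ - wbar]addrAC !(dotvDr l (w k - wbar)) !dotvZr.
  have -> : dotv e e = dotv (u k - rho *: w k) e - dotv l e.
    by rewrite -dotvNl -dotvDl /e opprD addrA.
  by rewrite -addrA !lerD2l ler_pM2l // -subr_le0.
move=> v sv.
suff : F (y k) + rho * dotv (w k - y k) (v - y k) - F v <= 0 by lra.
apply: (@le0_of_le_quadratic _ _ (rho / 2 * dotv (v - y k) (v - y k)) 1) => //.
move=> s /andP[s0 s1]; have s01 : 0 <= s <= 1 by rewrite (ltW s0).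
have := @polyhedral_convex _ _ G (y k) v s polyG s01.
have := min_y k (simplex_segment (simplex_y k) sv s01).
rewrite /F uE !sqr_enorm !dotvE !(dotvC v (y k)) !(dotvC _ (w k)).
rewrite !(dotvC (y k) l) !(dotvC v l); lra.
Qed.

(** The proximal inequality passes to the limit along iterates near [wbar], since the steps
    vanish. *)
Lemma limit_minimizes v : simplex v -> F wbar <= F v.
Proof.
move=> sv; have [r r0 prox] := proximal_step.
have [C C0 lipF] := polyhedral_lipschitz polyhedral_F.
apply/ler_addgt0Pr => e e0.
have q0 : 0 < rho * (enorm (v - wbar) + 2) + 2 * C.
  by rewrite addr_gt0 ?mulr_gt0 // ltr_wpDl ?enorm_ge0.
(* The total error is at most [e]: [2 * C] pays for moving from [y k] to [wbar], and [+ 2] for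
   replacing [enorm (v - y k)] by [enorm (v - wbar)]. *)
pose s := Num.min (Num.min 1 r) (e / (rho * (enorm (v - wbar) + 2) + 2 * C)).
have s0 : 0 < s by rewrite !lt_min ltr01 r0 divr_gt0.
have [s1 sr] : s <= 1 /\ s <= r by rewrite !ge_min !lexx ?orbT.
have se : s * (rho * (enorm (v - wbar) + 2) + 2 * C) <= e.
  by rewrite -ler_pdivlMr // ge_min lexx orbT.
have [N small] := small_steps s0; have [k Nk wk] := wbar_limit s0 N.
have [_ dk] := small k Nk.
have pk := prox k (lt_le_trans wk sr) v sv.
have lk := lipF wbar (y k).
have ck := normr_dotv_le (w k - y k) (v - y k).
have yk := enorm_triangle (w k) (y k) wbar.
have vk := enorm_triangle wbar v (y k).
rewrite (enormB wbar) in lk vk; rewrite (enormB (w k)) in ck.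
move: ck; rewrite ler_norml => /andP[ck _].
have vk2 : enorm (v - y k) <= enorm (v - wbar) + 2 by lra.
have dv : enorm (y k - w k) * enorm (v - y k) <= s * (enorm (v - wbar) + 2).
  by apply: ler_pM; rewrite ?enorm_ge0 // ltW.
have Cy : C * enorm (y k - wbar) <= C * (s + s) by rewrite ler_pM2l //; lra.
have : rho * (- (enorm (y k - w k) * enorm (v - y k))) <=
    rho * dotv (w k - y k) (v - y k) by rewrite ler_pM2l.
by have := ler_wpM2l (ltW rho_gt0) dv; lra.
Qed.

(* The subdifferentials of [F] plus the indicator of the simplex take finitely many
   values, so small proximal steps can only end at minimizers. *)
Lemma proximal_points_minimize : exists2 r : R, 0 < r & exists N,
  forall k, (N <= k)%N -> enorm (w k - wbar) < r -> F (y k) <= F wbar.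
Proof.
have [r r0 prox] := proximal_step; exists r => //.
have [I [a [b aF]]] := polyhedral_F.
apply: contrapT => /forallNP notN.
have freq N : exists2 k, (N <= k)%N & enorm (w k - wbar) < r /\ F wbar < F (y k).
  have /existsNP [k /not_implyP [Nk /not_implyP [wk /negP Fk]]] := notN N.
  by exists k => //; split=> //; rewrite ltNge.
have [t tP] := @frequently_pigeonhole ({set I} * {set 'I_n})%type _
  (fun k => (active a b F (y k), [set i | y k 0 i == 0]%SET)) freq.
have [k _ [[wk Fk] kt]] := tP 0%N.
have q0 : 0 < rho * (enorm (wbar - y k) + 1).
  by rewrite mulr_gt0 // ltr_wpDl ?enorm_ge0.
have gap : 0 < F (y k) - F wbar by rewrite subr_gt0.
have [N small] := small_steps (divr_gt0 gap q0).
have [j Nj [[wj _] jt]] := tP N; have [_ dj] := small j Nj.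
have [activeE zeroE] : active a b F (y j) = active a b F (y k) /\
    [set i | y j 0 i == 0]%SET = [set i | y k 0 i == 0]%SET.
  by move: jt; rewrite -kt => -[].
(* The short proximal step at [j] gives a tiny subgradient at [y k], too small for the fixed gap
   above [F wbar]. *)
have : F (y k) + dotv (rho *: (w j - y j)) (wbar - y k) <= F wbar.
  apply: (@subgrad_transfer _ _ (@simplex R n) _ _ _ _ (y k) (y j) _ aF) => //.
  - by rewrite activeE.
  - move=> v' sv'; apply: simplex_shift => // i yji.
    have : i \in [set i | y j 0 i == 0]%SET by rewrite inE yji.
    by rewrite zeroE inE => /eqP.
  - by move=> v' sv'; rewrite dotvZl; apply: prox.
move: dj; rewrite ltr_pdivlMr // dotvZl enormB => dj.
have := normr_dotv_le (w j - y j) (wbar - y k); rewrite ler_norml => /andP[+ _].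
have := enorm_ge0 (w j - y j); have := enorm_ge0 (wbar - y k); nra.
Qed.

(** A small shift of [y k] by a multiple of [m - wbar] is feasible and does not increase [F]: pieces
    active there are active at [wbar], so their slopes towards [m] are nonpositive. The proximal
    inequality at the shifted point gives the sign. *)
Lemma direction_acute : exists2 r : R, 0 < r & exists N,
  forall k, (N <= k)%N -> enorm (w k - wbar) < r ->
  forall m, simplex m -> F m <= F wbar -> 0 <= dotv (y k - w k) (m - wbar).
Proof.
have [r1 r1_gt0 prox] := proximal_step; have [I [a [b aF]]] := polyhedral_F.
have [r2 r2_gt0 near] := active_near aF wbar.
have [r3 r3_gt0 supp] := simplex_support_near simplex_wbar.
pose s := Num.min r1 (Num.min r2 r3) / 2.
have [s0 sr1 sr2 sr3] : [/\ 0 < s, s <= r1, s + s <= r2 & s + s <= r3].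
  have : 0 < Num.min r1 (Num.min r2 r3) by rewrite !lt_min r1_gt0 r2_gt0.
  have : Num.min r1 (Num.min r2 r3) <= r1 by rewrite !ge_min lexx.
  have : Num.min r1 (Num.min r2 r3) <= r2 by rewrite !ge_min lexx ?orbT.
  have : Num.min r1 (Num.min r2 r3) <= r3 by rewrite !ge_min lexx ?orbT.
  by rewrite /s; split; lra.
exists s => //; have [N small] := small_steps s0; exists N => k Nk wk m sm Fm.
have [_ dk] := small k Nk.
have yk : enorm (y k - wbar) < s + s.
  by have := enorm_triangle (w k) (y k) wbar; lra.
have [r4 r4_gt0 shift] := simplex_shift (simplex_y k) sm simplex_wbar
  (supp _ (lt_le_trans yk sr3)).
have q0 : 0 < enorm (m - wbar) + 1 by rewrite ltr_wpDl ?enorm_ge0.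
pose c := Num.min r4 ((s + s - enorm (y k - wbar)) / (enorm (m - wbar) + 1)).
have c0 : 0 < c by rewrite lt_min r4_gt0 divr_gt0 // subr_gt0.
have cr4 : c <= r4 by rewrite ge_min lexx.
have cs : c * (enorm (m - wbar) + 1) <= s + s - enorm (y k - wbar).
  by rewrite -ler_pdivlMr // ge_min lexx orbT.
set v := y k + c *: (m - wbar).
have sv : simplex v by apply: shift; rewrite c0.
have vr : enorm (v - wbar) < r2.
  rewrite /v addrAC; apply: le_lt_trans (enormD _ _) _.
  by rewrite enormZ gtr0_norm //; lra.
have [i iv] := active_exists aF v.
have ib := fintype.subsetP (near v vr) _ iv.
have Fv : F v <= F (y k).
  have /activeP -> := iv; have := active_ge aF m ib; have := aF.1 i (y k).
  rewrite /v !(dotvDr, dotvZr) => h1 h2.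
  have : dotv (a i) m + dotv (a i) (- wbar) <= 0 by lra.
  nra.
have := prox k (lt_le_trans wk sr1) v sv.
rewrite {2}/v addrK_l dotvZr -opprB dotvNl => h.
have : 0 <= rho * c * dotv (y k - w k) (m - wbar) by lra.
by rewrite pmulr_rge0 // mulr_gt0.
Qed.

(** If [y k] differs from [wbar], it is a minimizer whose pairing with [w k - wbar] is at least
    [enorm (y k - wbar) ^+ 2]. This persists for all later iterates and keeps them away from
    [wbar]. *)
Lemma eventually_hits_limit : exists N, forall k, (N <= k)%N ->
  H (w k) = H wbar + dotv l (w k - wbar) /\ y k = wbar.
Proof.
have [r1 r1_gt0 prox] := proximal_step.
have [r2 r2_gt0 [N2 minim]] := proximal_points_minimize.
have [r3 r3_gt0 [N3 acute]] := direction_acute.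
have [r4 r4_gt0 rH] := affH.
pose r := Num.min (Num.min r1 r2) (Num.min r3 r4).
have r0 : 0 < r by rewrite !lt_min r1_gt0 r2_gt0 r3_gt0.
have [rr1 rr2 rr3 rr4] : [/\ r <= r1, r <= r2, r <= r3 & r <= r4].
  by rewrite !ge_min !lexx ?orbT.
have [|N4 small] := @small_steps (r / 4); first lra.
pose N := maxn N2 (maxn N3 N4).
have NN k : (N <= k)%N -> [/\ (N2 <= k)%N, (N3 <= k)%N & (N4 <= k)%N].
  by rewrite !geq_max => /and3P.
have obtuse k : (N <= k)%N -> enorm (w k - wbar) < r ->
    enorm (y k - wbar) ^+ 2 <= dotv (w k - wbar) (y k - wbar).
  move=> Nk wk; have := prox k (lt_le_trans wk rr1) _ simplex_wbar.
  have := limit_minimizes (simplex_y k).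
  have -> : w k - y k = (w k - wbar) - (y k - wbar).
    by rewrite opprB addrA subrK.
  rewrite -(opprB (y k) wbar) dotvNr dotvDl dotvNl sqr_enorm => h1 h2.
  suff : 0 <= rho * (dotv (w k - wbar) (y k - wbar) - dotv (y k - wbar) (y k - wbar)).
    by rewrite pmulr_rge0 // subr_ge0.
  lra.
have mono k m : (N <= k)%N -> enorm (w k - wbar) < r ->
    simplex m -> F m <= F wbar ->
    dotv (w k - wbar) (m - wbar) <= dotv (w k.+1 - wbar) (m - wbar).
  move=> Nk wk sm Fm; have [_ Nk3 _] := NN k Nk.
  rewrite w_step addrAC (dotvDl (w k - wbar)) lerDl dotvZl mulr_ge0 //.
    exact: le_trans (lam_ge1 k).
  by apply: acute => //; apply: lt_le_trans wk _.
have minik k : (N <= k)%N -> enorm (w k - wbar) < r -> F (y k) <= F wbar.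
  by move=> /NN[? _ _] wk; apply: minim => //; apply: lt_le_trans wk _.
(* An iterate outside the ball would keep all later ones at distance at least [r / 2]: each is
   outside, or is held off by a minimizer [m] found on re-entry. *)
have stay k : (N <= k)%N -> enorm (w k - wbar) < r.
  move=> Nk; rewrite ltNge; apply/negP => wk.
  suff away i : r <= enorm (w (k + i) - wbar) \/
      exists m, [/\ simplex m, F m <= F wbar, r / 2 <= enorm (m - wbar) &
      enorm (m - wbar) ^+ 2 <= dotv (w (k + i) - wbar) (m - wbar)].
    have [|j kj wj] := wbar_limit (_ : 0 < r / 2) k; first lra.
    have := away (j - k)%N; rewrite subnKC // => -[|[m [_ _ rm mj]]]; first lra.
    by have := enorm_le_of_sqr_le_dotv mj; lra.
  elim: i => [|i IH]; first by left; rewrite addn0.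
  rewrite addnS; have Nki : (N <= k + i)%N := leq_trans Nk (leq_addr _ _).
  have [ge|lt] := leP r (enorm (w (k + i) - wbar)); last first.
    case: IH => [|[m [sm Fm rm mi]]]; first lra.
    by right; exists m; split=> //; apply: le_trans mi _; exact: mono.
  have [ge'|lt'] := leP r (enorm (w (k + i).+1 - wbar)); first by left.
  have Nki1 : (N <= (k + i).+1)%N := leqW Nki.
  right; exists (y (k + i).+1); split=> //; [exact: minik| |exact: obtuse].
  have [_ _ /small [h1 _]] := NN _ Nki; have [_ _ /small [_ h2]] := NN _ Nki1.
  have := enorm_triangle (w (k + i).+1) (w (k + i)) wbar.
  have := enorm_triangle (y (k + i).+1) (w (k + i).+1) wbar.
  by rewrite (enormB (w (k + i)) (w _)) (enormB _ (y _)); lra.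
exists N => k Nk; split; first exact: rH (lt_le_trans (stay k Nk) rr4).
apply/eqP; rewrite -subr_eq0; apply/negPn/negP => yk.
suff away i : enorm (y k - wbar) ^+ 2 <= dotv (w (k + i) - wbar) (y k - wbar).
  have [j kj wj] := wbar_limit (enorm_gt0 yk) k.
  by have := enorm_le_of_sqr_le_dotv (away (j - k)%N); rewrite subnKC // leNgt wj.
elim: i => [|i IH]; first by rewrite addn0 obtuse // stay.
have Nki : (N <= k + i)%N := leq_trans Nk (leq_addr _ _).
by rewrite addnS; apply: le_trans IH _; apply: mono; rewrite ?stay ?minik ?stay.
Qed.

Lemma linear_convergence_smoothH : exists C q : R, 0 <= C /\ 0 < q < 1 /\
  forall k, enorm (w k - wbar) <= C * q ^+ k.
Proof.
have [N hit] := eventually_hits_limit.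
case: (pselect (exists2 k, (N <= k)%N & w k = wbar)) => [[k Nk wk]|never].
  apply: (@linear_rate_of_eventually_eq _ _ w wbar k).
  by apply: stationary_of_phi_le; rewrite wk.
have w_neq k : (N <= k)%N -> w k - wbar != 0.
  by move=> Nk; rewrite subr_eq0; apply/eqP => wk; apply: never; exists k.
have lineE (v : 'rV[R]_n) (c : R) : v + c *: (wbar - v) = wbar + (1 - c) *: (v - wbar).
  by apply/matrixP => i j; rewrite !mxE; ring.
have zS k : (N <= k)%N -> w k.+1 - wbar = (1 - lam k) *: (w k - wbar).
  by move=> Nk; rewrite w_step (hit k Nk).2 lineE addrK_l.
have lam_gt1 k : (N <= k)%N -> 1 < lam k.
  move=> Nk; rewrite lt_neqAle lam_ge1 andbT; apply/eqP => lam1.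
  by have := w_neq _ (leqW Nk); rewrite zS // -lam1 subrr scale0r eqxx.
have zSS k : (N <= k)%N ->
    w k.+2 - wbar = ((lam k - 1) * (lam k.+1 - 1)) *: (w k - wbar).
  by move=> Nk; rewrite !zS ?leqW // scalerA; congr (_ *: _); ring.
have Fdec k : (N <= k)%N -> F (w k.+2) < F (w k).
  move=> Nk; have Nk2 : (N <= k.+2)%N by rewrite !leqW.
  have step0 : 0 < enorm (w k.+1 - w k) ^+ 2.
    rewrite exprn_gt0 // enorm_gt0 // w_step addrK_l (hit k Nk).2.
    rewrite scaler_eq0 negb_or -opprB oppr_eq0 w_neq // andbT gt_eqF //.
    exact: lt_trans (lam_gt1 k Nk).
  have := mulr_gt0 rho_gt0 step0; have := armijo k.
  have := phi_nonincreasing (leqnSn k.+1).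
  by rewrite /phi /F (hit k Nk).1 (hit _ Nk2).1 !dotvE; lra.
(* Otherwise [w k] lies between [wbar] and [w k.+2], and convexity with minimality of [wbar]
   contradicts [Fdec]. *)
have kappa k : (N <= k)%N -> (lam k - 1) * (lam k.+1 - 1) < 1.
  move=> Nk; rewrite ltNge; apply/negP; set c := _ * _ => c1.
  have c0 : 0 < c := lt_le_trans ltr01 c1.
  have := Fdec k Nk; apply/negP; rewrite -leNgt.
  have -> : w k = wbar + c^-1 *: (w k.+2 - wbar).
    by rewrite zSS // scalerA mulVf ?gt_eqF // scale1r addrC subrK.
  have ci : 0 <= c^-1 <= 1 by rewrite invr_ge0 (ltW c0) invf_le1.
  apply: le_trans (polyhedral_convex _ _ polyhedral_F ci) _.
  have := limit_minimizes (simplex_w k.+2); case/andP: ci; nra.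
(* The weight [lam] is at least 1, so [L] dominates the distance, and it is the quantity contracted
   by [beta] over two steps. *)
pose L i := lam (N + i) * enorm (w (N + i) - wbar).
have /andP[b0 b1] := beta01.
have sb0 : 0 < Num.sqrt beta by rewrite sqrtr_gt0.
have L0 i : 0 <= L i.
  by rewrite mulr_ge0 ?enorm_ge0 // (le_trans ler01) // lam_ge1.
have contraction i : L i.+2 <= Num.sqrt beta ^+ 2 * L i.
  rewrite sqr_sqrtr ?(ltW b0) // /L !addnS; set k := (N + i)%N.
  have Nk : (N <= k)%N := leq_addr _ _; have Nk1 := leqW Nk; have Nk2 := leqW Nk1.
  have A1 := lam_gt1 k Nk; have B1 := lam_gt1 _ Nk1; have C1 := lam_gt1 _ Nk2.
  case: (backtracking k) => [lam1|[a [A0 [AE sA maxA]]]].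
    by rewrite lam1 ltxx in A1.
  case: (backtracking k.+2) => [lam1|[c [C0 [CE sC maxC]]]].
    by rewrite lam1 ltxx in C1.
  rewrite (hit k Nk).2 in sA maxA; rewrite (hit _ Nk2).2 in sC maxC.
  set t := (lam k - 1) * (lam k.+1 - 1).
  have t0 : 0 < t by rewrite mulr_gt0 // subr_gt0.
  (* From [w k] and from [w k.+2] the maximal steps end at the same boundary point beyond [wbar];
     each maximality gives one inequality. *)
  have AC : A0 - 1 = t * (C0 - 1).
    apply/eqP; rewrite eq_le; apply/andP; split.
      rewrite mulrC -ler_pdivrMr // lerBrDl; apply: maxC.
      rewrite lineE zSS // scalerA.
      have -> : (1 - (1 + (A0 - 1) / t)) * t = 1 - A0.
        by field; rewrite gt_eqF.
      by rewrite -lineE.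
    rewrite lerBrDl; apply: maxA; rewrite lineE.
    have -> : 1 - (1 + t * (C0 - 1)) = (1 - C0) * t by ring.
    by rewrite -scalerA -zSS // -lineE.
  have := overshoot_contraction beta01 A1 B1 C1 AE CE AC (kappa k Nk) (kappa _ Nk1).
  rewrite zSS // -/t enormZ gtr0_norm // mulrA (mulrC (lam k.+2)) => h.
  by rewrite mulrA ler_wpM2r ?enorm_ge0.
have q0 : 0 <= L 0%N + L 1%N / Num.sqrt beta.
  by rewrite addr_ge0 // divr_ge0 // ltW.
have [||C C0 hC] := @linear_rate_of_tail R (Num.sqrt beta) _
    (fun k => enorm (w k - wbar)) N sb0 q0.
- by move=> k; exact: enorm_ge0.
- move=> i; apply: le_trans (geometric_of_two_step sb0 (L0 _) (L0 _) contraction i).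
  by rewrite ler_peMl ?enorm_ge0 // lam_ge1.
exists C, (Num.sqrt beta); split=> //; split=> //.
by rewrite sb0 -sqrtr1 ltr_sqrt.
Qed.

End SmoothH.
End BoostedDC.

(** * The penalized portfolio problem *)

Section Objective.
Variables (R : realType) (n S : nat) (x : 'I_S -> 'rV[R]_n) (p : 'I_S -> R).
Variables (alpha gamma rmin tau rho : R).
Hypotheses (p01 : forall j, 0 <= p j <= 1) (p1 : \sum_(j < S) p j = 1).
Hypotheses (alpha01 : 0 < alpha < 1) (gamma_gt0 : 0 < gamma).
Hypotheses (gamma_lt_alpha : gamma < alpha) (tau_gt0 : 0 < tau).

Definition g_polyhedral_part (w : 'rV[R]_n) : R :=
  ffun x p w + tau * Num.max (- (alpha / gamma) * CVaR x p alpha w + rmin)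
    (- ((alpha - gamma) / gamma) * CVaR x p (alpha - gamma) w).

Definition h_polyhedral_part (w : 'rV[R]_n) : R :=
  - (tau * ((alpha - gamma) / gamma) * CVaR x p (alpha - gamma) w).

Lemma gfunE w : gfun x p alpha gamma rmin tau rho w =
  rho / 2 * enorm w ^+ 2 + g_polyhedral_part w.
Proof. by rewrite /gfun addrA. Qed.

Lemma hfunE w : hfun x p alpha gamma tau rho w =
  rho / 2 * enorm w ^+ 2 + h_polyhedral_part w.
Proof. by []. Qed.

Lemma phiE w : phi x p alpha gamma rmin tau rho w =
  g_polyhedral_part w - h_polyhedral_part w.
Proof. by rewrite /phi gfunE hfunE opprD addrACA subrr add0r. Qed.

Lemma polyhedral_scaled_CVaR a c : 0 < a < 1 -> 0 <= c ->
  polyhedral (fun w => - (c * a) * CVaR x p a w).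
Proof.
move=> a01 c0; apply: eq_polyhedral (polyhedral_scale c0 (polyhedral_CVaR x p01 p1 a01)).
by move=> w; ring.
Qed.

Lemma alpha_gamma01 : 0 < alpha - gamma < 1.
Proof. by move: alpha01 gamma_gt0 gamma_lt_alpha => /andP[a0 a1] g0 ga; lra. Qed.

Lemma polyhedral_g : polyhedral g_polyhedral_part.
Proof.
have gi : 0 <= gamma^-1 by rewrite invr_ge0 ltW.
apply: polyhedral_add; last apply: polyhedral_scale (ltW tau_gt0) _.
  apply: eq_polyhedral (polyhedral_affine (- \sum_(j < S) p j *: x j) 0) => w.
  rewrite addr0 dotvNl dotv_suml; congr (- _); apply: eq_bigr => j _.
  by rewrite dotvZl dotvC.
apply: polyhedral_max.
  have := polyhedral_add (polyhedral_scaled_CVaR alpha01 gi) (polyhedral_affine 0 rmin).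
  by apply: eq_polyhedral => w; rewrite dot0v add0r (mulrC alpha).
apply: eq_polyhedral (polyhedral_scaled_CVaR alpha_gamma01 gi) => w.
by rewrite (mulrC (alpha - gamma)).
Qed.

Lemma polyhedral_h : polyhedral h_polyhedral_part.
Proof.
have c0 : 0 <= tau / gamma by rewrite divr_ge0 // ltW.
apply: eq_polyhedral (polyhedral_scaled_CVaR alpha_gamma01 c0) => w.
by rewrite /h_polyhedral_part; field; rewrite gt_eqF.
Qed.

End Objective.

(* Backtracking never goes below the step length 1, at which it becomes constant. *)
Lemma backtrack_bounds (R : realType) (beta l : R) j : 0 < beta < 1 -> 1 <= l ->
  let lj := iter j (fun l => Num.max 1 (beta * l)) l in
  1 <= lj <= l /\ (lj = 1 \/ lj = beta ^+ j * l).
Proof.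
move=> /andP[b0 b1] l1 /=; elim: j => [|j [/andP[lj1 ljl] IH]] /=.
  by rewrite l1 lexx; split=> //; right; rewrite expr0 mul1r.
set lj := iter _ _ _ in lj1 ljl IH *.
split.
  by rewrite le_max lexx ge_max l1 /=; nra.
case: (leP 1 (beta * lj)) => h; last by left.
case: IH => [E|->]; last by right; rewrite exprS mulrA.
by move: h; rewrite E mulr1 leNgt b1.
Qed.

(** Step length 1 lands on the feasible point [y]. *)
Lemma simplex_max_step_ge1 (R : realType) n (w y : 'rV[R]_n) (l : R) : simplex y ->
  (forall c, simplex (w + c *: (y - w)) -> c <= l) -> 1 <= l.
Proof. by move=> sy; apply; rewrite scale1r addrC subrK. Qed.
Theorem theorem3 (R : realType) (n S : nat) (x : 'I_S -> 'rV[R]_n) (p : 'I_S -> R)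
  (alpha gamma rmin tau rho beta : R) (w : nat -> 'rV[R]_n) (wbar : 'rV[R]_n) :
  (forall j, 0 <= p j <= 1) -> \sum_(j < S) p j = 1 ->
  0 < alpha < 1 ->
  0 < gamma ->
  (forall v, simplex v -> gamma < cvar_eps x p alpha v) ->
  0 < tau -> 0 < rho -> 0 < beta < 1 ->
  simplex (w 0%N) ->
  (forall k, bdca_step x p alpha gamma rmin tau rho beta (w k) (w k.+1)) ->
  simplex wbar ->
  (forall e : R, 0 < e -> forall N, exists2 k, (N <= k)%N & enorm (w k - wbar) < e) ->
  (loc_lip_grad (gfun x p alpha gamma rmin tau rho) wbar \/
   loc_lip_grad (hfun x p alpha gamma tau rho) wbar) ->
  exists C q : R, 0 <= C /\ 0 < q < 1 /\
    forall k, enorm (w k - wbar) <= C * q ^+ k.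
Proof.
move=> p01 p1 alpha01 gamma0 gamma_eps tau0 rho0 beta01 w0 steps wbarS limit lip.
(* [cvar_eps] is at most [alpha], since cumulative probabilities are nonnegative. *)
have gamma_alpha : gamma < alpha.
  have := gamma_eps _ w0; have := cum_prob_ge0 x p01 (w 0%N) (cvar_k x p alpha (w 0%N)).
  by rewrite /cvar_eps; lra.
pose G := g_polyhedral_part x p alpha gamma rmin tau.
pose H := h_polyhedral_part x p alpha gamma tau.
have polyG : polyhedral G by exact: polyhedral_g.
have polyH : polyhedral H by exact: polyhedral_h.
(* A stopped iteration is recorded with step length 1; feasibility of the new iterate is conditional
   on that of the old one, to be discharged by induction. *)
have /choice [u /choice [y /choice [lam stepP]]] k : exists u y lam,
    [/\ subgrad (hfun x p alpha gamma tau rho) (w k) u,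
        simplex y /\ (forall v, simplex v ->
          gfun x p alpha gamma rmin tau rho y - dotv y u <=
          gfun x p alpha gamma rmin tau rho v - dotv v u),
        1 <= lam /\ w k.+1 = w k + lam *: (y - w k),
        simplex (w k) -> simplex (w k.+1) /\
          G (w k.+1) - H (w k.+1) <=
          G (w k) - H (w k) - rho * enorm (w k.+1 - w k) ^+ 2 &
        lam = 1 \/ exists i lam0,
          [/\ lam = beta ^+ i * lam0, simplex (w k + lam0 *: (y - w k)) &
              forall c, simplex (w k + c *: (y - w k)) -> c <= lam0]].
  have [u [y [su [[sy miny] alt]]]] := steps k; exists u, y.
  case: alt => [[d0 wk1]|[d0 [lam0 [[slam0 maxlam] [j [_ [arm wk1]]]]]]].
    exists 1; split=> //; last by left.
      by rewrite d0 scaler0 addr0.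
    by rewrite wk1 subrr enorm0 expr0n mulr0 subr0.
  have lam0_ge1 := simplex_max_step_ge1 sy maxlam.
  move: arm wk1; set l := iter _ _ _ => arm wk1.
  have [/andP[l1 ll] lE] : 1 <= l <= lam0 /\ (l = 1 \/ l = beta ^+ j * lam0).
    exact: backtrack_bounds.
  exists l; split=> //; last by case: lE => lE; [left|right; exists j, lam0].
  move=> swk; split.
    rewrite wk1; apply: simplex_between slam0 _ => //.
    by rewrite (le_trans ler01 l1).
  move: arm; rewrite -wk1 !phiE => /le_trans; apply.
  by rewrite wk1 addrK_l enormZ exprMn real_normK ?num_real // !mulrA; exact: lexx.
have simplex_w k : simplex (w k).
  by elim: k => // k IH; have [_ _ _ /(_ IH)[]] := stepP k.
have sub_u k v : rho / 2 * enorm (w k) ^+ 2 + H (w k) + dotv (u k) (v - w k) <=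
    rho / 2 * enorm v ^+ 2 + H v.
  by have [su _ _ _ _] := stepP k; exact: su.
have simplex_y k : simplex (y k) by have [_ [sy _] _ _ _] := stepP k.
have min_y k v : simplex v ->
    rho / 2 * enorm (y k) ^+ 2 + G (y k) - dotv (y k) (u k) <=
    rho / 2 * enorm v ^+ 2 + G v - dotv v (u k).
  by have [_ [_ my] _ _ _] := stepP k; move=> /my; rewrite !gfunE.
have lam_ge1 k : 1 <= lam k by have [_ _ [l1 _] _ _] := stepP k.
have w_step k : w k.+1 = w k + lam k *: (y k - w k) by have [_ _ [_ E] _ _] := stepP k.
have armijo k : G (w k.+1) - H (w k.+1) <=
    G (w k) - H (w k) - rho * enorm (w k.+1 - w k) ^+ 2.
  by have [_ _ _ /(_ (simplex_w k))[]] := stepP k.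
have diff F : loc_lip_grad F wbar -> differentiable F wbar.
  by move=> [r [r0 [L [+ _]]]]; apply; rewrite subrr enorm0.
case: lip => /diff dF.
  have [l affG] : exists l, locally_affine G wbar l.
    apply: (locally_affine_of_differentiable (c := rho / 2)) => //.
    by rewrite (_ : (fun v => _) = gfun x p alpha gamma rmin tau rho) //;
      apply/funext => v; rewrite gfunE.
  have [N wN] := finite_termination_smoothG polyG polyH rho0 sub_u simplex_y min_y
    simplex_w lam_ge1 w_step armijo wbarS limit affG.
  exact: linear_rate_of_eventually_eq wN.
have [l affH] : exists l, locally_affine H wbar l.
  exact: (locally_affine_of_differentiable (c := rho / 2)).
apply: (linear_convergence_smoothH polyG polyH rho0 beta01 sub_u simplex_y min_y
  simplex_w lam_ge1 w_step armijo wbarS limit affH).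
by move=> k; have [_ _ _ _] := stepP k.
Qed.
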